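(* Let $t\ge 0$ be an integer and let $I\subset K[x_1,\dots,x_n]$ be a $t$-spread strongly stable ideal. Then for all $i\ge 0$ and $j\ge 1$, $$\beta_{i,i+j}(I)=\sum_{u\in G(I)_j}\binom{\max(u)-t(j-1)-1}{i}.$$
   Context: $K$ is a field. A monomial $x_{i_1}x_{i_2}\cdots x_{i_d}$ with $i_1\le i_2\le\cdots\le i_d$ is called $t$-spread if $i_j-i_{j-1}\ge t$ for $2\le j\le d$. A $t$-spread monomial ideal is an ideal generated by $t$-spread monomials. For a monomial $u$, $\operatorname{supp}(u)=\{j : x_j \text{ divides } u\}$ and $\max(u)$ is the largest index $i$ such that $x_i$ divides $u$. A $t$-spread monomial ideal $I$ is called $t$-spread strongly stable if for all $t$-spread monomials $u\in I$, all $j\in\operatorname{supp}(u)$ and all $i<j$ such that $x_i(u/x_j)$ is $t$-spread, one has $x_i(u/x_j)\in I$. $G(I)$ denotes the unique minimal set of monomial generators of $I$ and $G(I)_j=\{u\in G(I):\deg u=j\}$. $\beta_{i,k}(I)=\dim_K\operatorname{Tor}_i(K,I)_k$ are the graded Betti numbers of $I$ over the polynomial ring. *)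

(* Defs.v *)
From HB Require Import structures.
From mathcomp Require Import all_boot all_order all_algebra.
From mathcomp Require Export mpoly.
From Stdlib Require Import ClassicalEpsilon.

Set Implicit Arguments.
Unset Strict Implicit.
Unset Printing Implicit Defensive.

Import GRing.Theory.
Local Open Scope ring_scope.

(* Monomials are exponent vectors m : 'X_{1..n}.  Ordinals start at 0, so the *)
(* variable x_k is indexed by the ordinal k - 1.                              *)

Section Monomials.
Variables (n t : nat).
Implicit Types m : 'X_{1..n}.

(* The nondecreasing sequence i_1 <= ... <= i_d of indices, with multiplicity *)
Definition mnm_indices m : seq 'I_n :=
  flatten [seq nseq (m i) i | i <- enum 'I_n].

Definition tspread m : bool :=
  sorted (fun i j : 'I_n => i + t <= j)%N (mnm_indices m).

Definition mnm_supp m : {set 'I_n} := [set j | m j != 0%N].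

(* 1-based; equal to 0 for the monomial 1 *)
Definition mnm_max m : nat := (\max_(i in mnm_supp m) i.+1)%N.

End Monomials.

Section MonomialIdeals.
Variables (K : fieldType) (n t : nat).
Implicit Types (I : {pred {mpoly K[n]}}) (G : {pred 'X_{1..n}}).

Definition generated_by I G : Prop :=
  forall p : {mpoly K[n]}, p \in I <->
    exists2 s : seq ({mpoly K[n]} * 'X_{1..n}),
      {in s, forall c, c.2 \in G} & p = \sum_(c <- s) c.1 * 'X_[c.2].

Definition tspread_monomial_ideal I : Prop :=
  exists2 G : {pred 'X_{1..n}}, {in G, forall m, tspread t m}
                              & generated_by I G.

Definition tspread_strongly_stable I : Prop :=
  tspread_monomial_ideal I /\
  forall (u : 'X_{1..n}) (i j : 'I_n),
    tspread t u -> 'X_[u] \in I -> j \in mnm_supp u -> (i < j)%N ->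
    tspread t (U_(i) + (u - U_(j)))%MM -> 'X_[(U_(i) + (u - U_(j)))%MM] \in I.

Definition minimal_generators I G : Prop :=
  generated_by I G /\
  forall G' : {pred 'X_{1..n}},
    {subset G' <= G} -> generated_by I G' -> {subset G <= G'}.

End MonomialIdeals.

(* Graded free modules of finite rank over S = K[x_1, ..., x_n] are written   *)
(* F_i = \bigoplus_a S(- twist i a), with elements the row vectors; maps act  *)
(* by multiplication on the right, diff i : F_(i+1) -> F_i, aug : F_0 -> S.   *)
Record graded_free_complex (K : fieldType) (n : nat) := GradedFreeComplex {
  rk : nat -> nat;
  twist : forall i, 'I_(rk i) -> nat;
  diff : forall i, 'M[{mpoly K[n]}]_(rk i.+1, rk i);
  aug : 'cV[{mpoly K[n]}]_(rk 0)
}.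

Definition zero_complex (K : fieldType) (n : nat) : graded_free_complex K n :=
  @GradedFreeComplex K n (fun=> 0%N) (fun _ _ => 0%N) (fun=> 0) 0.

Section Tor.
Variables (K : fieldType) (n : nat).
Implicit Types (I : {pred {mpoly K[n]}}) (F : graded_free_complex K n).

(* aug and diff are homogeneous of degree 0, and                              *)
(* ... -> F_2 -> F_1 -> F_0 -> I -> 0 is exact                                *)
Record graded_free_resolution I F : Prop := GradedFreeResolution {
  aug_homog : forall a, {in msupp (aug F a 0), forall m, mdeg m = twist a};
  diff_homog : forall i a b, {in msupp (diff F i a b), forall m,
    (mdeg m + twist b = twist a)%N};
  exact_aug : forall p, p \in I <->
    exists v : 'rV[{mpoly K[n]}]_(rk F 0), p = (v *m aug F) 0 0;
  exact_0 : forall v : 'rV[{mpoly K[n]}]_(rk F 0), v *m aug F = 0 <->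
    exists w : 'rV[{mpoly K[n]}]_(rk F 1), v = w *m diff F 0;
  exact_S : forall i (v : 'rV[{mpoly K[n]}]_(rk F i.+1)), v *m diff F i = 0 <->
    exists w : 'rV[{mpoly K[n]}]_(rk F i.+2), v = w *m diff F i.+1
}.

(* The differential of K \otimes F, where K = S / (x_1, ..., x_n) is obtained *)
(* by taking constant coefficients.                                           *)
Definition diffK F i : 'M[K]_(rk F i.+1, rk F i) :=
  map_mx (mcoeff 0%MM) (diff F i).

(* The map leaving degree i; it is 0 for i = 0, as aug is dropped in          *)
(* K \otimes F.                                                               *)
Definition diffK_out F i : 'M[K]_(rk F i, rk F i.-1) :=
  match i with 0 => 0 | i'.+1 => diffK F i' end.

(* Its row space is the component of degree k of K \otimes F_i.               *)
Definition degree_part F i k : 'M[K]_(rk F i) :=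
  diag_mx (\row_a (twist a == k)%:R).

(* dim_K H_i(K \otimes F)_k, as dim (cycles) - dim (boundaries)               *)
Definition homology_dim F i k : nat :=
  (\rank (kermx (diffK_out F i) :&: degree_part F i k)%MS
   - \rank (degree_part F i.+1 k *m diffK F i))%N.

Definition free_resolution I : graded_free_complex K n :=
  epsilon (inhabits (zero_complex K n)) (graded_free_resolution I).

(* dim_K Tor_i(K, I)_k, which does not depend on the resolution chosen        *)
Definition graded_betti I i k : nat := homology_dim (free_resolution I) i k.

End Tor.

(* Main.v *)
Require Import Defs.
From mathcomp Require Import all_boot all_order all_algebra.
From mathcomp Require Import zify.
From Stdlib Require Import ClassicalEpsilon.

(* Order the minimal generators by degree and, within a degree, by the sum of *)
(* the indices of their variables.  If u = x_{j_1} ... x_{j_d}, the colon     *)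
(* ideal (previous generators) : u is then generated by the variables x_i     *)
(* with i < j_d lying in none of the intervals [j_l, j_l + t - 1], l < d;     *)
(* there are max(u) - t(d - 1) - 1 of them.                                   *)
(* Adding the generators one at a time, the mapping cone of a comparison map  *)
(* from the Koszul complex on these variables, shifted by deg u, to the       *)
(* resolution built so far resolves the larger ideal.  It is minimal because  *)
(* all comparison maps beyond the first have entries of positive degree.      *)
(* Hence its ranks are the Betti numbers, as homotopy equivalence shows that  *)
(* K \otimes F has the same homology for every graded free resolution F.      *)

Set Implicit Arguments.
Unset Strict Implicit.
Unset Printing Implicit Defensive.

Import GRing.Theory.
Local Open Scope ring_scope.

(** Why the colon ideals are generated by the variables in the gaps of u = x_{j_1} ... x_{j_d}: if i
    lies in a gap, replacing the first variable of u beyond that gap by x_i gives a t-spread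
    monomial. It is in I by stability and divides x_i u, and a generator dividing it precedes u
    ([gap_colon_sub]). Conversely, let g precede u. At some position the index of g is below that of
    u, for otherwise stability and minimality of the generators would force g = u. The first such
    index lies in a gap of u and occurs more often in g than in u, so its variable divides every m
    with g | m u ([gap_colon_sup]). The gaps are counted in [size_gap_vars].

    On the homological side, adding u contributes binom(c, i) free generators of degree i + deg u in
    homological degree i, where c is the number of gap variables ([linear_quotient_step],
    [linear_quotients_resolution]). Hence only generators u of degree j matter in degree i + j. By
    [minimal_homology_dim] these ranks are the homology dimensions of the minimal resolution, and
    [homology_dim_le], used in both directions, carries them over to the resolution chosen in
    [graded_betti]. *)

(** Builds chain maps and homotopies degree by degree: [P] is the invariant that lets the next
    component exist, [R] the equation between consecutive components. *)
Lemma dependent_choice_nat (T : nat -> Type) (P : forall i, T i -> Prop)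
    (R : forall i, T i -> T i.+1 -> Prop) (x0 : T 0%N) :
  P 0%N x0 ->
  (forall i x, P i x -> exists2 y, P i.+1 y & R i x y) ->
  exists f : forall i, T i, f 0%N = x0 /\ forall i, R i (f i) (f i.+1).
Proof.
move=> P0 step.
pose next i (x : {x : T i | P i x}) : {y : T i.+1 | P i.+1 y /\ R i (sval x) y} :=
  constructive_indefinite_description _
    (let: ex_intro2 y Py Ry := step i (sval x) (svalP x) in
     ex_intro _ y (conj Py Ry)).
pose g := fix g i : {x : T i | P i x} :=
  match i with
  | 0 => exist (P 0%N) x0 P0
  | i'.+1 => exist (P i'.+1) (sval (next i' (g i'))) (svalP (next i' (g i'))).1
  end.
exists (fun i => sval (g i)); split=> // i.
exact: (svalP (next i (g i))).2.
Qed.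

(** * Homogeneous matrices and augmented resolutions *)

Section Homogeneous.
Variables (K : fieldType) (n : nat).
Local Notation S := {mpoly K[n]}.

(** A degree-0 map from the sum of the S(- ta a) to the sum of the S(- tb b), acting on row vectors.
    An entry with [tb b > ta a] is forced to vanish. *)
Definition homog_mx p q (ta : 'I_p -> nat) (tb : 'I_q -> nat) (A : 'M[S]_(p, q)) :=
  [forall a, forall b, all (fun m => mdeg m + tb b == ta a)%N (msupp (A a b))].

Lemma homog_mx_suppP p q (ta : 'I_p -> nat) (tb : 'I_q -> nat) (A : 'M[S]_(p, q)) :
  homog_mx ta tb A <->
  forall a b, {in msupp (A a b), forall m, (mdeg m + tb b)%N = ta a}.
Proof.
split=> [/forallP hA a b m|hA].
  by have /forallP/(_ b)/allP := hA a; move=> /(_ m) h /h /eqP.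
by apply/forallP=> a; apply/forallP=> b; apply/allP=> m /hA ->.
Qed.

Lemma homog_mxP p q (ta : 'I_p -> nat) (tb : 'I_q -> nat) (A : 'M[S]_(p, q)) :
  homog_mx ta tb A <->
  forall a b m, (mdeg m + tb b)%N != ta a -> (A a b)@_m = 0.
Proof.
rewrite homog_mx_suppP; split=> hA a b m; last first.
  by rewrite mcoeff_msupp; apply: contraNeq => /hA ->.
by move=> h; apply: memN_msupp_eq0; apply: contra h => /hA ->.
Qed.

Lemma eq_homog_mx p q (ta ta' : 'I_p -> nat) tb (A : 'M[S]_(p, q)) :
  ta =1 ta' -> homog_mx ta tb A -> homog_mx ta' tb A.
Proof. by move=> e /homog_mxP hA; apply/homog_mxP=> a b m; rewrite -e => /hA. Qed.

Lemma homog_mxM p q r ta tb tc (A : 'M[S]_(p, q)) (B : 'M_(q, r)) :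
  homog_mx ta tb A -> homog_mx tb tc B -> homog_mx ta tc (A *m B).
Proof.
move=> /homog_mxP hA /homog_mxP hB; apply/homog_mxP=> a c m hm.
rewrite mxE raddf_sum big1 // => b _ /=; rewrite mcoeffM big1 // => k /eqP mE.
have [h|/hA ->] := eqVneq (mdeg k.1 + tb b)%N (ta a); last by rewrite mul0r.
rewrite (hB b c k.2) ?mulr0 //; apply: contra hm => /eqP h2.
by rewrite mE mdegD -addnA h2 h.
Qed.

Lemma homog_mxD p q ta tb (A B : 'M[S]_(p, q)) :
  homog_mx ta tb A -> homog_mx ta tb B -> homog_mx ta tb (A + B).
Proof.
move=> /homog_mxP hA /homog_mxP hB; apply/homog_mxP=> a b m hm.
by rewrite mxE mcoeffD hA // hB // addr0.
Qed.

Lemma homog_mxN p q ta tb (A : 'M[S]_(p, q)) :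
  homog_mx ta tb A -> homog_mx ta tb (- A).
Proof.
move=> /homog_mxP hA; apply/homog_mxP=> a b m hm.
by rewrite mxE mcoeffN hA // oppr0.
Qed.

Lemma homog_mx0 p q ta tb : homog_mx ta tb (0 : 'M[S]_(p, q)).
Proof. by apply/homog_mxP=> a b m _; rewrite mxE mcoeff0. Qed.

Lemma homog_mx1 p ta : homog_mx ta ta (1%:M : 'M[S]_p).
Proof.
apply/homog_mxP=> a b m; rewrite mxE.
have [->|_] := eqVneq a b; last by rewrite mcoeff0.
by rewrite mcoeff1; have [->|//] := eqVneq m 0%MM; rewrite mdeg0 eqxx.
Qed.

Definition mono_part (Q : pred 'X_{1..n}) (p : S) : S :=
  \sum_(m <- msupp p | Q m) p@_m *: 'X_[m].

Lemma mcoeff_mono_part Q p m :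
  (mono_part Q p)@_m = if Q m then p@_m else 0.
Proof.
rewrite raddf_sum /=; under eq_bigr do rewrite mcoeffZ mcoeffX.
have [mp|/memN_msupp_eq0 p0] := boolP (m \in msupp p); last first.
  rewrite p0 if_same big1_seq // => k _.
  by have [->|] := eqVneq k m; rewrite ?p0 ?mul0r ?mulr0.
rewrite big_mkcond (bigD1_seq m) ?msupp_uniq //= eqxx mulr1.
by rewrite big1 ?addr0 // => k /negPf ->; rewrite mulr0 if_same.
Qed.

(* The homogeneous component of any lift is a lift. *)
Lemma homog_lift p q r ta tb tc (A : 'M[S]_(q, r)) (B : 'M[S]_(p, r)) :
  homog_mx tb tc A -> homog_mx ta tc B ->
  (forall a, exists w : 'rV_q, row a B = w *m A) ->
  exists2 C : 'M_(p, q), homog_mx ta tb C & C *m A = B.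
Proof.
move=> /homog_mxP hA /homog_mxP hB hrow.
pose w a := sval (constructive_indefinite_description _ (hrow a)).
have wE a : row a B = w a *m A.
  exact: svalP (constructive_indefinite_description _ (hrow a)).
exists (\matrix_(a, b) mono_part (fun m => mdeg m + tb b == ta a)%N (w a 0 b)).
  by apply/homog_mxP=> a b m hm; rewrite mxE mcoeff_mono_part (negPf hm).
apply/matrixP=> a c; apply/mpolyP=> m.
have [hm|hm] := eqVneq (mdeg m + tc c)%N (ta a); last first.
  rewrite (hB _ _ _ hm) mxE raddf_sum big1 // => b _ /=.
  rewrite mcoeffM big1 // => k /eqP mE; rewrite mxE mcoeff_mono_part.
  case: eqP => [h|]; last by rewrite mul0r.
  rewrite hA ?mulr0 //; apply: contra hm => /eqP h2.
  by rewrite mE mdegD -addnA h2 h.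
have -> : B a c = (w a *m A) 0 c by rewrite -wE mxE.
rewrite !mxE !raddf_sum; apply: eq_bigr => b _ /=.
rewrite !mcoeffM; apply: eq_bigr => k /eqP mE; rewrite mxE mcoeff_mono_part.
have [//|h] := eqVneq (mdeg k.1 + tb b)%N (ta a).
rewrite [(A b c)@_ _]hA ?mulr0 //; apply: contra h => /eqP h2.
rewrite -hm -h2 addnA -mdegD; apply/eqP; congr (mdeg _ + _)%N.
exact: esym.
Qed.

End Homogeneous.

Section Augmented.
Variables (K : fieldType) (n : nat).
Local Notation S := {mpoly K[n]}.
Implicit Types (F : graded_free_complex K n) (I : {pred S}).

(* The augmented complex of [F] is indexed from [0], with [S] in degree [0]. *)
Definition erk F i : nat := if i is i'.+1 then rk F i' else 1.

Definition etwist F i : 'I_(erk F i) -> nat :=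
  match i with 0 => fun=> 0%N | i'.+1 => @twist K n F i' end.

Definition ediff F i : 'M[S]_(erk F i.+1, erk F i) :=
  match i with 0 => aug F | i'.+1 => diff F i' end.

(** In degree 0 the ideal itself plays the role of the cycles, so that surjectivity onto I and
    exactness become a single clause, [ediff_exact]. *)
Definition ecycle I F i : 'rV[S]_(erk F i) -> Prop :=
  match i with
  | 0 => fun v => v 0 0 \in I
  | i'.+1 => fun v => v *m ediff F i' = 0
  end.

Record aug_resolution I F : Prop := AugResolution {
  ediff_homog : forall i, homog_mx (@etwist F i.+1) (@etwist F i) (ediff F i);
  ediff_exact : forall i (v : 'rV_(erk F i)),
    ecycle I v <-> exists w : 'rV_(erk F i.+1), v = w *m ediff F i
}.

Arguments ediff_homog {I F} _ i.
Arguments ediff_exact {I F} _ i v.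

Lemma aug_resolutionP I F : graded_free_resolution I F <-> aug_resolution I F.
Proof.
split=> [[hA hD e e0 eS]|[hD ex]].
  split=> [[|i]|[|[|i]] v].
  - by apply/homog_mx_suppP=> a b m; rewrite /= [b]ord1 addn0; apply: hA.
  - by apply/homog_mx_suppP; apply: hD.
  - rewrite /= e; split=> [[w wE]|[w ->]]; exists w => //.
    by apply/rowP=> j; rewrite !ord1.
  - exact: e0.
  - exact: eS.
split=> [a m hm|i a b m|p|v|i v].
- by have /homog_mx_suppP/(_ a 0 m hm) := hD 0%N; rewrite /= addn0.
- by have /homog_mx_suppP := hD i.+1; apply.
- have := ex 0%N p%:M; rewrite /= mxE eqxx mulr1n => ->.
  split=> -[w wE]; exists w.
    by rewrite -wE mxE eqxx mulr1n.
  by apply/rowP=> j; rewrite !ord1 wE mxE eqxx mulr1n.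
- exact: (ex 1%N).
- exact: (ex i.+2).
Qed.

Lemma eq_aug_resolution I J F : (forall p, p \in I <-> p \in J) ->
  aug_resolution I F -> aug_resolution J F.
Proof.
move=> IJ [hD ex]; split=> // -[|i] v; last exact: (ex i.+1).
by rewrite -(ex 0%N) /= IJ.
Qed.

Lemma ediffK I F i : aug_resolution I F -> ediff F i.+1 *m ediff F i = 0.
Proof.
move=> [_ ex]; apply/row_matrixP=> a; rewrite row0 row_mul.
have [_] := ex i.+1 (row a (ediff F i.+1)); apply.
by exists (delta_mx 0 a); rewrite rowE.
Qed.

(** The inductive step of every comparison argument: cycles are boundaries, and the preimages of the
    rows can be taken homogeneous. *)
Lemma homog_lift_cycle I F i p (ta : 'I_p -> nat) (B : 'M_(p, erk F i)) :
  aug_resolution I F -> homog_mx ta (@etwist F i) B ->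
  (forall a, ecycle I (row a B)) ->
  exists2 C : 'M_(p, erk F i.+1), homog_mx ta (@etwist F i.+1) C
                                & C *m ediff F i = B.
Proof.
move=> [hD ex] hB cB; apply: (homog_lift (hD i) hB) => a.
by apply/ex.
Qed.

End Augmented.

Arguments ediff_homog {K n I F} _ i.
Arguments ediff_exact {K n I F} _ i v.

(** * Independence of the resolution *)

Section ChainMaps.
Variables (K : fieldType) (n : nat).
Local Notation S := {mpoly K[n]}.
Implicit Types (F H : graded_free_complex K n) (I J : {pred S}).

Lemma homog_mx_shift d p q ta tb (A : 'M[S]_(p, q)) : homog_mx ta tb A ->
  homog_mx (fun a => ta a + d)%N (fun b => tb b + d)%N A.
Proof.
move=> /homog_mxP hA; apply/homog_mxP=> a b m.
by rewrite addnA eqn_add2r; apply: hA.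
Qed.

(** The comparison theorem. It is used with d = 0 to lift the identity of an ideal, and with d = deg
    u to lift multiplication by u from I : u to I. *)
Lemma chain_map_exists d I J F H (f0 : 'M[S]_(erk H 0, erk F 0)) :
  aug_resolution I F -> aug_resolution J H ->
  homog_mx (fun a => @etwist _ _ H 0 a + d)%N (@etwist _ _ F 0) f0 ->
  (forall a, ecycle I (row a (ediff H 0 *m f0))) ->
  exists f : forall i, 'M[S]_(erk H i, erk F i),
  [/\ f 0%N = f0,
      forall i, homog_mx (fun a => @etwist _ _ H i a + d)%N (@etwist _ _ F i) (f i)
    & forall i, f i.+1 *m ediff F i = ediff H i *m f i].
Proof.
move=> rF rH hf0 cf0.
pose P i (f : 'M[S]_(erk H i, erk F i)) :=
  homog_mx (fun a => @etwist _ _ H i a + d)%N (@etwist _ _ F i) f /\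
  forall a, ecycle I (row a (ediff H i *m f)).
pose R i (f : 'M[S]_(erk H i, erk F i)) (f' : 'M[S]_(erk H i.+1, erk F i.+1)) :=
  homog_mx (fun a => @etwist _ _ H i a + d)%N (@etwist _ _ F i) f /\
  f' *m ediff F i = ediff H i *m f.
have [||f [fE fR]] := @dependent_choice_nat _ P R f0.
- by split.
- move=> i f [hf cf].
  have hB := homog_mxM (homog_mx_shift d (ediff_homog rH i)) hf.
  have [C hC CE] := homog_lift_cycle rF hB cf; exists C; last by split.
  split=> // a /=; rewrite -row_mul -mulmxA CE mulmxA (ediffK i rH).
  by rewrite mul0mx row0.
by exists f; split=> // i; have [] := fR i.
Qed.

(** With d the differential, each h_{i+1} - d s_i is a cycle because h is a chain map, and s_{i+1}
    is a homogeneous lift of it. The start s_0 = 0 is possible because h vanishes on S. *)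
Lemma null_homotopic I F (h : forall i, 'M[S]_(erk F i)) :
  aug_resolution I F -> h 0%N = 0 ->
  (forall i, homog_mx (@etwist _ _ F i) (@etwist _ _ F i) (h i)) ->
  (forall i, h i.+1 *m ediff F i = ediff F i *m h i) ->
  exists s : forall i, 'M[S]_(erk F i, erk F i.+1),
  [/\ s 0%N = 0,
      forall i, homog_mx (@etwist _ _ F i) (@etwist _ _ F i.+1) (s i)
    & forall i, h i.+1 = s i.+1 *m ediff F i.+1 + ediff F i *m s i].
Proof.
move=> rF h0 hh hd.
pose P i (s : 'M[S]_(erk F i, erk F i.+1)) :=
  homog_mx (@etwist _ _ F i) (@etwist _ _ F i.+1) s /\
  ediff F i *m (h i - s *m ediff F i) = 0.
pose R i (s : 'M[S]_(erk F i, erk F i.+1)) (s' : 'M[S]_(erk F i.+1, erk F i.+2)) :=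
  homog_mx (@etwist _ _ F i) (@etwist _ _ F i.+1) s /\
  h i.+1 = s' *m ediff F i.+1 + ediff F i *m s.
have [||s [sE sR]] := @dependent_choice_nat _ P R 0.
- by split; [exact: homog_mx0 | rewrite h0 mul0mx subr0 mulmx0].
- move=> i s [hs cs].
  have hB : homog_mx (@etwist _ _ F i.+1) (@etwist _ _ F i.+1)
      (h i.+1 - ediff F i *m s).
    apply: homog_mxD (hh _) _; apply: homog_mxN.
    exact: homog_mxM (ediff_homog rF i) hs.
  have [|C hC CE] := homog_lift_cycle rF hB.
    move=> a /=; rewrite -row_mul mulmxBl hd -mulmxA -mulmxBr cs.
    by rewrite row0.
  exists C; last by split=> //; rewrite CE subrK.
  split=> //; rewrite CE opprB addrC subrK mulmxA (ediffK i rF).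
  by rewrite mul0mx.
by exists s; split=> // i; have [] := sR i.
Qed.

End ChainMaps.

(** If z f lies in B', then z f g lies in B, hence so does z. Thus on a complement C of the
    intersection of Z and B in Z, the map f is injective and its image meets B' trivially, so rank C
    + rank B' is at most rank Z'. *)
Lemma rank_subquotient_le (K : fieldType) (m m' p p' q q' : nat)
    (Z : 'M[K]_(m, p)) (B : 'M_(q, p)) (Z' : 'M_(m', p')) (B' : 'M_(q', p'))
    (f : 'M_(p, p')) (g : 'M_(p', p)) :
  (Z *m f <= Z')%MS -> (B' <= Z')%MS -> (B' *m g <= B)%MS ->
  (forall z : 'rV_p, (z <= Z)%MS -> (z - z *m f *m g <= B)%MS) ->
  (\rank Z - \rank B <= \rank Z' - \rank B')%N.
Proof.
move=> Zf BZ' Bg hgf; set C := (Z :\: B)%MS.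
have CB (c : 'rV_p) : (c <= C)%MS -> (c *m f <= B')%MS -> c = 0.
  move=> cC cB; apply/eqP; rewrite -submx0 -(capmx_diff Z B) sub_capmx cC /=.
  have cZ : (c <= Z)%MS by apply: submx_trans cC _; apply: diffmxSl.
  rewrite -[c](subrK (c *m f *m g)) addmx_sub ?hgf //.
  exact: submx_trans (submxMr _ cB) Bg.
have rC : \rank (C *m f) = \rank C.
  rewrite -(mxrank_mul_ker C f); apply/eqP.
  rewrite -[X in X == _]addn0 eqn_add2l eq_sym mxrank_eq0 -submx0.
  apply/rV_subP=> c; rewrite sub_capmx => /andP[cC /sub_kermxP cf].
  by rewrite (CB c) ?cf ?sub0mx.
have capCB : (C *m f :&: B' = 0)%MS.
  apply/eqP; rewrite -submx0; apply/rV_subP=> x.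
  rewrite sub_capmx => /andP[/submxP[y ->]]; rewrite mulmxA => yB.
  by rewrite (CB (y *m C)) ?submxMl ?mul0mx ?sub0mx.
have sumZ : (C *m f + B' <= Z')%MS.
  rewrite addsmx_sub BZ' andbT; apply: submx_trans Zf.
  by apply: submxMr; apply: diffmxSl.
have := mxrankS sumZ; rewrite mxrank_disjoint_sum // rC.
have := mxrank_cap_compl Z B; have := mxrankS (capmxSr Z B).
rewrite -/C; set z := \rank Z; set b := \rank B; move=> h1 <- h2.
rewrite leq_subLR; apply: leq_trans (leq_add h1 (leqnn _)) _.
by rewrite leq_add2l leq_subRL ?mxrankS // addnC.
Qed.

Section Homology.
Variables (K : fieldType) (n : nat).
Local Notation S := {mpoly K[n]}.
Implicit Types (F H : graded_free_complex K n) (I J : {pred S}).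
Local Notation const0 := (map_mx (mcoeff (R := K) (n := n) 0%MM)).

(** A nonzero constant coefficient can occur only between equal twists, so reduction modulo the
    variables commutes with the projections to degree k. *)
Lemma const_degree_part p q ta tb (A : 'M[S]_(p, q)) k : homog_mx ta tb A ->
  diag_mx (\row_a (ta a == k)%:R) *m const0 A
    = const0 A *m diag_mx (\row_b (tb b == k)%:R).
Proof.
move=> /homog_mxP hA; apply/matrixP=> a b.
rewrite mul_diag_mx mul_mx_diag !mxE mulrC.
have [<-//|h] := eqVneq (tb b) (ta a).
by rewrite hA ?mul0r // mdeg0.
Qed.

(** Lifting the identity of I both ways gives chain maps f and g with 1 - f g null-homotopic. After
    tensoring with K, z - z f g is a boundary for every cycle z, also in each degree k, and
    [rank_subquotient_le] applies. *)
Lemma homology_dim_le I F H i k :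
  aug_resolution I F -> aug_resolution I H ->
  (homology_dim F i k <= homology_dim H i k)%N.
Proof.
move=> rF rH.
have chain1 (A B : graded_free_complex K n) :
    aug_resolution I A -> aug_resolution I B ->
    exists f : forall i, 'M[S]_(erk A i, erk B i),
    [/\ f 0%N = 1%:M,
        forall i, homog_mx (@etwist _ _ A i) (@etwist _ _ B i) (f i)
      & forall i, f i.+1 *m ediff B i = ediff A i *m f i].
  move=> rA rB.
  have [||f [f0 hf fd]] := @chain_map_exists K n 0 I I B A 1%:M rB rA.
  - by apply: eq_homog_mx (homog_mx1 _ _ _) => a; rewrite addn0.
  - move=> a; rewrite mulmx1.
    have [_] := ediff_exact rA 0 (row a (ediff A 0)); apply.
    by exists (delta_mx 0 a); rewrite rowE.
  exists f; split=> // j; apply: eq_homog_mx (hf j) => a.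
  by rewrite addn0.
have [f [f0 hf fd]] := chain1 _ _ rF rH.
have [g [g0 hg gd]] := chain1 _ _ rH rF.
have [|||s [s0 hs sd]] := @null_homotopic K n I F (fun i => 1%:M - f i *m g i) rF.
- by rewrite f0 g0 mulmx1 subrr.
- move=> j; apply: homog_mxD; first exact: homog_mx1.
  by apply: homog_mxN; apply: homog_mxM.
- move=> j; rewrite mulmxBl mulmxBr mulmx1 mul1mx -mulmxA gd mulmxA fd.
  by rewrite -mulmxA.
have DhK j j' (A B : graded_free_complex K n) (X : 'M[S]_(erk A j.+1, erk B j'.+1)) :
    homog_mx (@etwist _ _ A j.+1) (@etwist _ _ B j'.+1) X ->
    degree_part A j k *m const0 X = const0 X *m degree_part B j' k.
  exact: const_degree_part.
have dDK j A : aug_resolution I A ->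
    degree_part A j.+1 k *m diffK A j = diffK A j *m degree_part A j k.
  move=> rA; apply: const_degree_part; exact: (ediff_homog rA j.+1).
have idem j (A : graded_free_complex K n) :
    degree_part A j k *m degree_part A j k = degree_part A j k.
  rewrite mul_diag_mx; apply/matrixP=> a b; rewrite !mxE.
  by case: (_ == k); rewrite ?mul1r // mul0rn mulr0.
(* For i = 0 the outgoing differential of K \otimes F is 0, whereas the homotopy term passes through
   [aug F]; it vanishes since [s 0 = 0]. *)
have [X XE] : exists X, const0 (ediff F i *m s i) = diffK_out F i *m X.
  case: i => [|i]; last by exists (const0 (s i.+1)); rewrite map_mxM.
  by exists 0; rewrite s0 !mulmx0 map_mx0.
apply: (@rank_subquotient_le _ _ _ _ _ _ _ _ _ _ _
         (const0 (f i.+1)) (const0 (g i.+1))).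
- have kfout : (kermx (diffK_out F i) *m const0 (f i.+1)
                 <= kermx (diffK_out H i))%MS.
    apply/sub_kermxP; case: i {X XE} => [|i]; first by rewrite mulmx0.
    rewrite -mulmxA -map_mxM (fd i.+1) map_mxM mulmxA.
    by rewrite mulmx_ker mul0mx.
  rewrite sub_capmx (submx_trans (submxMr _ (capmxSl _ _)) kfout) /=.
  apply: submx_trans (submxMr _ (capmxSr _ _)) _.
  by rewrite (DhK _ _ _ _ _ (hf _)) submxMl.
- rewrite sub_capmx dDK // submxMl andbT; apply/sub_kermxP.
  rewrite -(dDK _ _ rH) -mulmxA; case: i {X XE} => [|i]; first by rewrite !mulmx0.
  by rewrite -map_mxM (ediffK i.+1 rH) map_mx0 mulmx0.
- rewrite -mulmxA -map_mxM -(gd i.+1) map_mxM mulmxA.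
  by rewrite (DhK _ _ _ _ _ (hg _)) -mulmxA submxMl.
- move=> z; rewrite sub_capmx => /andP[/sub_kermxP zo /submxP[y zE]].
  have zD : z *m degree_part F i k = z by rewrite zE -mulmxA idem.
  have -> : z - z *m const0 (f i.+1) *m const0 (g i.+1)
      = z *m const0 (s i.+1) *m diffK F i.
    rewrite -!mulmxA -!map_mxM -{1}[z]mulmx1.
    rewrite -(@map_mx1 _ _ (mcoeff (R := K) (n := n) 0%MM)) -mulmxBr -map_mxB sd map_mxD mulmxDr [X in _ + X = _](_ : _ = 0) ?addr0 //.
    by rewrite XE mulmxA zo mul0mx.
  by rewrite -zD -(mulmxA z) (DhK _ _ _ _ _ (hs _)) mulmxA -mulmxA submxMl.
Qed.

End Homology.

(** * Mapping cones and linear quotients *)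

Section MinimalHomology.
Variables (K : fieldType) (n : nat).
Local Notation S := {mpoly K[n]}.
Implicit Types (F H : graded_free_complex K n).

Definition minimal_complex F := forall i, diffK F i = 0.

Lemma rank_diag_mx m (d : 'rV[K]_m) : \rank (diag_mx d) = (\sum_i (d 0%R i != 0%R))%N.
Proof.
elim: m d => [|m IHm] d; first by rewrite big_ord0 [diag_mx d]flatmx0 mxrank0.
pose l := lsubmx (d : 'rV_(1 + m)); pose r := rsubmx (d : 'rV_(1 + m)).
have E : \rank (diag_mx (d : 'rV_(1 + m))) = (\rank (diag_mx l) + \rank (diag_mx r))%N.
  by rewrite -rank_diag_block_mx -diag_mx_row hsubmxK.
rewrite [LHS]E IHm big_ord_recl; congr addn.
  rewrite rank_rV; congr (nat_of_bool (~~ _)).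
  apply/eqP/eqP=> [/matrixP/(_ 0 0)|h].
    by rewrite !mxE eqxx mulr1n => h; rewrite -[RHS]h; congr (d _ _); apply: val_inj.
  apply/matrixP=> a b; rewrite !ord1 !mxE eqxx mulr1n -[RHS]h.
  by congr (d _ _); apply: val_inj.
by apply: eq_bigr => i _; rewrite mxE; congr (nat_of_bool (d _ _ != 0)); apply: val_inj.
Qed.

(** All differentials of K \otimes F vanish, so the homology is the whole module and its dimension
    counts the generators of degree k. *)
Lemma minimal_homology_dim F i k : minimal_complex F ->
  homology_dim F i k = (\sum_(a < rk F i) (twist a == k))%N.
Proof.
move=> minF; rewrite /homology_dim minF mulmx0 mxrank0 subn0.
have -> : diffK_out F i = 0 by case: i => [|i] //=; apply: minF.
rewrite (cap_eqmx (kermx0 _ _ _) (eqmx_refl _)) cap1mx.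
rewrite rank_diag_mx; apply: eq_bigr => a _; rewrite mxE.
by case: (_ == k); rewrite ?oner_eq0 ?eqxx.
Qed.

End MinimalHomology.

Section MappingCone.
Variables (K : fieldType) (n : nat).
Local Notation S := {mpoly K[n]}.
Implicit Types (F H : graded_free_complex K n) (I J : {pred S}).

Definition sum_twist p q (ta : 'I_p -> nat) (tb : 'I_q -> nat) (a : 'I_(p + q)) :=
  match split a with inl b => ta b | inr c => tb c end.

Lemma homog_block_mx p1 p2 q1 q2 ta1 ta2 tb1 tb2
    (A : 'M[S]_(p1, q1)) (B : 'M_(p1, q2)) (C : 'M_(p2, q1)) (D : 'M_(p2, q2)) :
  homog_mx ta1 tb1 A -> homog_mx ta1 tb2 B ->
  homog_mx ta2 tb1 C -> homog_mx ta2 tb2 D ->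
  homog_mx (sum_twist ta1 ta2) (sum_twist tb1 tb2) (block_mx A B C D).
Proof.
move=> /homog_mxP hA /homog_mxP hB /homog_mxP hC /homog_mxP hD.
apply/homog_mxP=> a b m; rewrite mxE /sum_twist.
by case: (split a) => a'; rewrite mxE; case: (split b) => b'; auto.
Qed.

Lemma homog_col_mx p1 p2 q ta1 ta2 tb (A : 'M[S]_(p1, q)) (B : 'M_(p2, q)) :
  homog_mx ta1 tb A -> homog_mx ta2 tb B ->
  homog_mx (sum_twist ta1 ta2) tb (col_mx A B).
Proof.
move=> /homog_mxP hA /homog_mxP hB.
apply/homog_mxP=> a b m; rewrite mxE /sum_twist.
by case: (split a) => a'; auto.
Qed.

(* The augmented complex of [H], shifted by [d], is placed one degree higher,
   hence [erk H i] in degree [i]. *)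
Definition cone d F H (f : forall i, 'M[S]_(erk H i, erk F i)) :
    graded_free_complex K n :=
  {| rk i := (rk F i + erk H i)%N;
     twist i := sum_twist (@twist _ _ F i) (fun a => @etwist _ _ H i a + d)%N;
     diff i := block_mx (diff F i) 0 (f i.+1) (- ediff H i);
     aug := col_mx (aug F) (f 0%N) |}.

(** The hypotheses say J = I : u and I' = I + (u), so I'/I is (S/J)(-d). The augmented complex of H
    resolves S/J, and the comparison map f lifts multiplication by u. Exactness of the cone is
    checked directly on pairs (x, y). *)
Lemma cone_resolution I J I' F H (u : S) d :
  {in msupp u, forall m, mdeg m = d} ->
  (forall p, p \in J <-> p * u \in I) ->
  (forall p, p \in I' <-> exists c, p - c * u \in I) ->
  aug_resolution I F -> aug_resolution J H ->
  exists f : forall i, 'M[S]_(erk H i, erk F i),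
    (forall i, homog_mx (fun a => @etwist _ _ H i a + d)%N (@etwist _ _ F i) (f i))
    /\ aug_resolution I' (cone d f).
Proof.
move=> hu hJ hI' rF rH.
have [||f [f0 hf fd]] := @chain_map_exists K n d I J F H u%:M rF rH.
- apply/homog_mx_suppP=> a b m; rewrite !ord1 mxE eqxx mulr1n => /hu ->.
  by rewrite addn0.
- move=> a /=; rewrite mul_mx_scalar mxE mxE mulrC; apply/hJ.
  have [_] := ediff_exact rH 0 (row a (ediff H 0)); rewrite /= mxE; apply.
  by exists (delta_mx 0 a); rewrite rowE.
exists f; split=> //.
(* For i = 0 the second condition follows from the first: the equation puts y u in I, that is, y in
   J. *)
have cycE i (x : 'rV_(erk F i.+1)) (y : 'rV_(erk H i)) :
    row_mx x y *m ediff (cone d f) i = 0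
      <-> x *m ediff F i + y *m f i = 0 /\ ecycle J y.
  case: i x y => [|i] x y /=.
    rewrite mul_row_col; split=> [h|[] //]; split=> //; apply/hJ.
    have [_] := ediff_exact rF 0 (y *m f 0%N).
    rewrite f0 mul_mx_scalar /= mxE mulrC; apply; exists (- x).
    by rewrite mulNmx; apply/eqP; rewrite -addr_eq0 addrC -mul_mx_scalar -f0 h.
  rewrite mul_row_block mulmx0 add0r mulmxN; split=> [h|[-> ->]].
    have [-> /eqP] := eq_row_mx (etrans h (esym (row_mx0 _ _ _ _))).
    by rewrite oppr_eq0 => /eqP ->.
  by rewrite oppr0 row_mx0.
split=> [[|i]|[|i] v].
- apply: homog_col_mx (hf 0%N); exact: (ediff_homog rF 0).
- apply: homog_block_mx (hf i.+1) _; first exact: (ediff_homog rF i.+1).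
    exact: homog_mx0.
  by apply: homog_mxN; apply: homog_mx_shift (ediff_homog rH i).
- rewrite /ecycle hI'; split=> [[c cI]|[w ->]].
    have [x xE] : exists x, v - (c * u)%:M = x *m ediff F 0.
      apply/(ediff_exact rF 0).
      by rewrite /= mxE [X in _ + X]mxE [X in - X]mxE eqxx mulr1n.
    exists (row_mx x c%:M); rewrite mul_row_col -[aug F]/(ediff F 0) -xE f0.
    by rewrite -scalar_mxM subrK.
  rewrite -(hsubmxK w) mul_row_col f0; exists (rsubmx w 0 0).
  have [_] := ediff_exact rF 0 (lsubmx w *m aug F).
  have -> : (lsubmx w *m aug F + rsubmx w *m u%:M) 0 0 - rsubmx w 0 0 * u
     = (lsubmx w *m aug F) 0 0.
    by rewrite mxE mul_mx_scalar [X in _ + X - _]mxE mulrC addrK.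
  by apply; exists (lsubmx w).
rewrite /ecycle -(hsubmxK v) cycE; split=> [[xy]|[w]].
  move=> /(ediff_exact rH i)[w wE].
  (* For a cycle (x, y) with y = w d, the vector x + w f is a cycle of F, hence p d for some p. Then
     (p, - w) is a preimage of (x, y), the sign matching [- ediff H i]. *)
  have [p pE] : exists p : 'rV_(erk F i.+2),
      lsubmx (v : 'rV_(rk F i + erk H i)) + w *m f i.+1 = p *m ediff F i.+1.
    apply/(ediff_exact rF i.+1).
    by rewrite /= mulmxDl -mulmxA fd mulmxA -wE.
  exists (row_mx p (- w)); rewrite mul_row_block mulmx0 add0r !mulNmx mulmxN opprK.
  by rewrite -wE -[diff F i]/(ediff F i.+1) -pE addrK.
rewrite -(hsubmxK (w : 'rV_(rk F i.+1 + erk H i.+1))) mul_row_block mulmx0 add0r.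
move=> /eq_row_mx[-> yE]; split; last first.
  by apply/(ediff_exact rH i); eexists; rewrite yE mulmxN -mulNmx.
rewrite yE mulmxDl -!mulmxA fd (ediffK i rF) mulmx0 add0r.
by rewrite mulNmx mulmxN subrr.
Qed.

End MappingCone.

(** * Monomial ideals, Koszul complexes and resolutions from linear quotients *)

Section MonomialIdeal.
Variables (K : fieldType) (n : nat).
Local Notation S := {mpoly K[n]}.
Implicit Types (m u : 'X_{1..n}) (s : seq 'X_{1..n}).

Definition mono_mult s m := has (fun g => (g <= m)%MM) s.

(** A polynomial lies in a monomial ideal exactly when all its monomials do, so membership is a
    condition on the support. *)
Definition mono_ideal s : {pred S} := fun p => all (mono_mult s) (msupp p).

Lemma mono_idealP s p :
  p \in mono_ideal s <-> forall m, p@_m != 0 -> mono_mult s m.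
Proof.
split=> [/allP h m|h]; first by rewrite -mcoeff_msupp => /h.
by apply/allP=> m; rewrite mcoeff_msupp => /h.
Qed.

Lemma mono_ideal_colon s s' u p :
  (forall m, mono_mult s (m + u) = mono_mult s' m) ->
  p \in mono_ideal s' <-> p * 'X_[u] \in mono_ideal s.
Proof.
move=> su; suff -> : (p * 'X_[u] \in mono_ideal s) = (p \in mono_ideal s') by [].
rewrite !unfold_in (perm_all _ (msuppMX p u)) all_map; apply: eq_all => m.
by rewrite /= addmC su.
Qed.

Lemma mono_ideal_cons s u p :
  p \in mono_ideal (u :: s) <-> exists c, p - c * 'X_[u] \in mono_ideal s.
Proof.
split=> [/mono_idealP hp|[c /mono_idealP hp]].
  exists (\sum_(m <- msupp p | (u <= m)%MM) p@_m *: 'X_[m - u]).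
  rewrite mulr_suml (eq_bigr (fun m => p@_m *: 'X_[m])); last first.
    by move=> m um; rewrite -scalerAl -mpolyXD submK.
  apply/mono_idealP=> m; rewrite mcoeffB -/(mono_part (fun m => u <= m)%MM p).
  rewrite mcoeff_mono_part; case: ifP => um; first by rewrite subrr eqxx.
  by rewrite subr0 => /hp; rewrite /mono_mult /= um.
apply/mono_idealP=> m; rewrite -[p](subrK (c * 'X_[u])) mcoeffD.
have [->|h _] := eqVneq (p - c * 'X_[u])@_m 0; last first.
  by rewrite /mono_mult /= -/(mono_mult s m) hp // orbT.
rewrite add0r -mcoeff_msupp (perm_mem (msuppMX c u)) => /mapP[m' _ ->].
by rewrite /mono_mult /= lem_addr.
Qed.

Lemma zero_complex_resolution : aug_resolution (mono_ideal [::]) (zero_complex K n).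
Proof.
split=> [i|[|i] v].
- by apply/homog_mxP => -[].
- rewrite /= mono_idealP; split=> [h|[w ->] m]; last first.
    by rewrite mxE big_ord0 mcoeff0 eqxx.
  exists 0; rewrite mul0mx; apply/rowP=> j; rewrite ord1 mxE.
  apply/mpolyP=> m; rewrite mcoeff0; apply/eqP.
  by apply: contraT => /h.
- split=> _; last by apply/rowP; case: i v => [|i] v j; rewrite !mxE big_ord0.
  by exists 0; apply/rowP=> -[].
Qed.

(** The Koszul complex as an iterated cone: for v outside [vs], the ideal generated by [vs] is its
    own colon by x_v, so two copies of the same resolution are joined and the ranks obey Pascal's
    rule. *)
Lemma koszul_resolution (vs : seq 'I_n) : uniq vs ->
  exists H : graded_free_complex K n,
  [/\ aug_resolution (mono_ideal [seq U_(i)%MM | i <- vs]) H,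
      forall i a, @etwist _ _ H i a = i
    & forall i, erk H i = 'C(size vs, i)].
Proof.
elim: vs => [|v vs IH] /=.
  exists (zero_complex K n); split; first exact: zero_complex_resolution.
    by case=> [|i] // [].
  by case.
case/andP=> v_vs /IH[H [rH tH kH]].
have [|||f [hf rC]] := cone_resolution (I := mono_ideal [seq U_(i)%MM | i <- vs])
  (I' := mono_ideal (U_(v)%MM :: [seq U_(i)%MM | i <- vs])) (u := 'X_v)
  (d := 1%N) _ _ _ rH rH.
- by move=> m; rewrite msuppX inE => /eqP ->; rewrite mdeg1.
- move=> p; apply: mono_ideal_colon => m; rewrite /mono_mult !has_map.
  apply: eq_in_has => j j_vs /=; rewrite !lep1mP mnmDE mnm1E.
  by have [E|_] := eqVneq v j; [rewrite E j_vs in v_vs | rewrite addn0].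
- by move=> p; apply: mono_ideal_cons.
exists (cone 1 f); split=> //.
  case=> [|i] a //=; rewrite /sum_twist; case: split => b.
    exact: (tH i.+1).
  by rewrite tH addn1.
case=> [|i]; first by rewrite bin0.
by rewrite /= kH -[rk H i]/(erk H i.+1) kH binS.
Qed.

(** The bound i + d on the twists is the induction invariant that keeps the next cone minimal. *)
Definition has_minimal_resolution (I : {pred S}) (d : nat) (b : nat -> nat -> nat) :=
  exists F, [/\ aug_resolution I F, minimal_complex F,
                forall i a, (@twist _ _ F i a <= i + d)%N
              & forall i k, (\sum_(a < rk F i) (twist a == k) = b i k)%N].

Lemma const_eq0 p q ta tb (A : 'M[S]_(p, q)) : homog_mx ta tb A ->
  (forall a b, tb b != ta a) -> map_mx (mcoeff 0%MM) A = 0.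
Proof.
move=> /homog_mxP hA ht; apply/matrixP=> a b; rewrite !mxE.
by apply: hA; rewrite mdeg0; apply: ht.
Qed.

Lemma linear_quotient_step s u (vs : seq 'I_n) d b :
  has_minimal_resolution (mono_ideal s) d b -> (d <= mdeg u)%N -> uniq vs ->
  (forall m, mono_mult s (m + u) = has (fun i => m i != 0%N) vs) ->
  has_minimal_resolution (mono_ideal (u :: s)) (mdeg u)
    (fun i k => b i k + 'C(size vs, i) * (i + mdeg u == k))%N.
Proof.
move=> [F [rF mF tF bF]] du uvs col.
have [H [rH tH kH]] := koszul_resolution uvs.
have [|||f [hf rC]] := cone_resolution (I' := mono_ideal (u :: s)) (u := 'X_[u])
  (d := mdeg u) _ _ _ rF rH.
- by move=> m; rewrite msuppX inE => /eqP ->.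
- move=> p; apply: mono_ideal_colon => m; rewrite col /mono_mult has_map.
  by apply: eq_has => i; rewrite /= lep1mP.
- by move=> p; apply: mono_ideal_cons.
exists (cone (mdeg u) f); split=> //.
- move=> i; rewrite /diffK /= map_block_mx map_mx0 -/(diffK F i) mF.
  (* The source has twist i + 1 + deg u and the target twist at most i + d with d <= deg u, so all
     entries have positive degree. The component [f 0] enters only the augmentation. *)
  rewrite (const_eq0 (hf i.+1)); last first.
    move=> a c; rewrite tH neq_ltn (leq_trans _ (_ : i.+1 + d <= _))%N //=.
      exact: tF.
    by rewrite leq_add2l.
  rewrite (const_eq0 (homog_mxN (ediff_homog rH i))) ?block_mx0 // => a c.
  by rewrite !tH neq_ltn ltnSn.
- move=> i a /=; rewrite /sum_twist; case: split => c; last by rewrite tH.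
  by apply: leq_trans (tF i c) _; rewrite leq_add2l.
move=> i k; rewrite /= big_split_ord /= -bF; congr addn.
  apply: eq_bigr => a _; congr (nat_of_bool (_ == _)).
  by rewrite /sum_twist -[lshift _ _]/(unsplit (inl a)) unsplitK.
rewrite (eq_bigr (fun=> nat_of_bool (i + mdeg u == k)%N)); last first.
  move=> a _; congr (nat_of_bool (_ == _)).
  by rewrite /sum_twist -[rshift _ _]/(unsplit (inr a)) unsplitK tH.
by rewrite sum_nat_const card_ord kH.
Qed.

(** The list is built from its end: the tail [s2] holds the generators already resolved when u is
    added, and the variables [q u] generate its colon by u. *)
Lemma linear_quotients_resolution s (q : 'X_{1..n} -> seq 'I_n) :
  (forall s1 u s2, s = s1 ++ u :: s2 ->
    [/\ uniq (q u), {in s2, forall g, mdeg g <= mdeg u}%N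
      & forall m, mono_mult s2 (m + u) = has (fun i => m i != 0%N) (q u)]) ->
  exists d, has_minimal_resolution (mono_ideal s) d
    (fun i k => \sum_(u <- s) 'C(size (q u), i) * (i + mdeg u == k))%N.
Proof.
move=> hs; suff: has_minimal_resolution (mono_ideal s) (\max_(u <- s) mdeg u)
    (fun i k => \sum_(u <- s) 'C(size (q u), i) * (i + mdeg u == k))%N.
  by exists (\max_(u <- s) mdeg u)%N.
elim: s hs => [|u s IH] hs.
  exists (zero_complex K n); split; first exact: zero_complex_resolution.
  - by move=> i; apply/matrixP => -[].
  - by move=> i [].
  - by move=> i k; rewrite big_ord0 big_nil.
have [uq du col] := hs [::] u s erefl.
have {}IH : has_minimal_resolution (mono_ideal s) (\max_(u <- s) mdeg u)
    (fun i k => \sum_(u <- s) 'C(size (q u), i) * (i + mdeg u == k))%N.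
  by apply: IH => s1 v s2 E; apply: (hs (u :: s1)); rewrite E.
have le_max : (\max_(u <- s) mdeg u <= mdeg u)%N.
  by apply/bigmax_leqP_seq => g /du.
have [F [rF mF tF bF]] := linear_quotient_step IH le_max uq col.
exists F; split=> //; first by rewrite big_cons (maxn_idPl le_max).
by move=> i k; rewrite bF big_cons addnC.
Qed.

End MonomialIdeal.

(** * Linear quotients of t-spread strongly stable ideals *)

Section IndexSequences.
Variables (n t : nat).
Implicit Types (m : 'X_{1..n}) (s p r k : seq 'I_n) (i x y : 'I_n).
Local Open Scope nat_scope.

Definition spread_rel : rel 'I_n := fun x y => x + t <= y.

Definition mnm_seq s : 'X_{1..n} := [multinom count_mem i s | i < n].

Definition mnm_weight m : nat := \sum_i m i * i.

Lemma mnm_seq_cons x s : mnm_seq (x :: s) = (U_(x) + mnm_seq s)%MM.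
Proof. by apply/mnmP=> i; rewrite mnmDE mnm1E !mnmE. Qed.

Lemma mdeg_mnm_seq s : mdeg (mnm_seq s) = size s.
Proof.
elim: s => [|x s IH]; last by rewrite mnm_seq_cons mdegD mdeg1 IH.
by apply/eqP; rewrite mdeg_eq0; apply/eqP/mnmP=> i; rewrite !mnmE.
Qed.

Lemma mnm_weight_seq s : mnm_weight (mnm_seq s) = \sum_(x <- s) x.
Proof.
rewrite /mnm_weight; under eq_bigr => i _ do rewrite mnmE.
elim: s => [|x s IH]; first by rewrite big_nil big1.
rewrite big_cons -IH [in LHS](eq_bigr (fun i : 'I_n => (x == i) * i + count_mem i s * i)).
  rewrite big_split /= (bigD1 x) //= eqxx mul1n big1 ?addn0 // => i.
  by rewrite eq_sym => /negPf ->.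
by move=> i _; rewrite mulnDl.
Qed.

(** The exchange x_i (u / x_j) of strong stability replaces one entry of the index sequence. *)
Lemma mnm_seq_replace p r x y :
  mnm_seq (p ++ x :: r) = (U_(x) + (mnm_seq (p ++ y :: r) - U_(y)))%MM.
Proof.
apply/mnmP=> i; rewrite mnmDE mnmBE !mnm1E !mnmE !count_cat /=; lia.
Qed.

Lemma mnm_indicesK : cancel (@mnm_indices n) mnm_seq.
Proof.
move=> m; apply/mnmP=> i; rewrite mnmE count_flatten -map_comp sumnE big_map big_enum /=.
rewrite (bigD1 i) //= count_nseq /= eqxx mul1n big1 ?addn0 // => j /negPf ij.
by rewrite count_nseq /= ij.
Qed.

Lemma sorted_mnm_indices m : pairwise (fun i j : 'I_n => i <= j) (mnm_indices m).
Proof.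
have : pairwise (fun i j : 'I_n => i <= j) (enum 'I_n).
  have : sorted leq (map val (enum 'I_n)) by rewrite val_enum_ord iota_sorted.
  by rewrite (sorted_pairwise leq_trans) pairwise_map.
rewrite /mnm_indices; elim: (enum 'I_n) => //= x s IH /andP[/allP xs /IH ps].
rewrite pairwise_cat ps andbT; apply/andP; split.
  apply/allrelP=> y z /nseqP[-> _] /flattenP[_ /mapP[w /xs xw ->]].
  by move=> /nseqP[-> _].
by elim: (m x) => //= c ->; rewrite andbT all_nseq leqnn orbT.
Qed.

(** A t-spread sequence is nondecreasing, and nondecreasing sequences with the same multiplicities
    coincide. *)
Lemma mnm_seqK s : pairwise spread_rel s -> mnm_indices (mnm_seq s) = s.
Proof.
have leT_tr : transitive (fun i j : 'I_n => i <= j).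
  by move=> a b c; apply: leq_trans.
move=> ps; apply: (sorted_eq leT_tr).
- by move=> a b; rewrite -eqn_leq => /eqP/val_inj.
- by rewrite (sorted_pairwise leT_tr) sorted_mnm_indices.
- rewrite (sorted_pairwise leT_tr); apply: sub_pairwise ps => a b.
  by apply: leq_trans; apply: leq_addr.
by apply/allP=> x _ /=; have /mnmP/(_ x) := mnm_indicesK (mnm_seq s); rewrite !mnmE => ->.
Qed.

Lemma spread_rel_trans : transitive spread_rel.
Proof. by rewrite /spread_rel => a b c; lia. Qed.

Lemma tspreadE m : tspread t m = pairwise spread_rel (mnm_indices m).
Proof. by rewrite /tspread (sorted_pairwise spread_rel_trans). Qed.

Lemma tspread_mnm_seq s : pairwise spread_rel s -> tspread t (mnm_seq s).
Proof. by move=> ps; rewrite tspreadE mnm_seqK. Qed.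

Lemma mnm_max_seq x s : pairwise spread_rel (x :: s) ->
  mnm_max (mnm_seq (x :: s)) = (last x s).+1.
Proof.
move=> ps; have suppE i : (i \in mnm_supp (mnm_seq (x :: s))) = (i \in x :: s).
  by rewrite inE mnmE -has_pred1 has_count lt0n.
apply/eqP; rewrite eqn_leq; apply/andP; split; last first.
  by apply: (@leq_bigmax_cond _ _ (fun i : 'I_n => i.+1)); rewrite suppE mem_last.
apply/bigmax_leqP=> i; rewrite suppE lastI mem_rcons inE => /predU1P[->//|ib].
move: ps; rewrite lastI pairwise_rcons => /andP[/allP/(_ i ib)].
by rewrite /spread_rel; lia.
Qed.

(* [lo] is the least index allowed by the variable preceding [s]. *)
Fixpoint in_gap (lo : nat) s (i : nat) : bool :=
  if s is x :: s' then (lo <= i < x) || in_gap (x + t) s' i else false.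

Lemma in_gap_ge lo x s i : lo <= x -> path spread_rel x s ->
  in_gap lo (x :: s) i -> lo <= i.
Proof.
elim: s lo x => [|y s IH] lo x /= lox; first by rewrite orbF => _ /andP[].
move=> /andP[xy ps] /orP[/andP[]//|/(IH (x + t) y xy ps)]; lia.
Qed.

(** Here [y] is the first entry beyond the gap containing i. The conditions on [p] and [y] are what
    keeps the sequence t-spread when [y] is replaced by i. *)
Lemma in_gap_split lo x s i : lo <= x -> path spread_rel x s ->
  in_gap lo (x :: s) i -> exists p y r,
    [/\ x :: s = p ++ y :: r, i < y & all (fun z : 'I_n => z + t <= i) p].
Proof.
elim: s lo x => [|y s IH] lo x lox.
  by rewrite /= orbF => _ /andP[_ ix]; exists [::], x, [::].
move=> /= /andP[xy ps] /orP[/andP[_ ix]|gi].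
  by exists [::], x, (y :: s).
have [p [z [r [-> iz pi]]]] := IH (x + t) y xy ps gi.
exists (x :: p), z, r; split=> //=; rewrite pi andbT.
exact: in_gap_ge xy ps gi.
Qed.

Lemma split_in_gap lo p y r i : lo <= i -> i < y ->
  all (fun z : 'I_n => z + t <= i) p -> in_gap lo (p ++ y :: r) i.
Proof.
elim: p lo => [|x p IH] lo loi iy /=; first by rewrite loi iy.
by case/andP=> xi pi; rewrite (IH (x + t)) ?orbT.
Qed.

Lemma sum_interval lo x N : \sum_(i < N) (lo <= i < x) = minn N x - lo.
Proof.
elim: N => [|N IH]; first by rewrite big_ord0 min0n.
by rewrite big_ord_recr /= IH; lia.
Qed.

(** The gaps are disjoint of lengths j_1 - lo, j_2 - j_1 - t, ..., j_d - j_{d-1} - t, and the sum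
    telescopes. *)
Lemma sum_in_gap lo x s : lo <= x -> path spread_rel x s ->
  (\sum_(i < n) in_gap lo (x :: s) i) + lo + t * size s = last x s.
Proof.
elim: s lo x => [|y s IH] lo x lox.
  move=> _ /=; under eq_bigr => i _ do rewrite orbF.
  by rewrite sum_interval (minn_idPr (ltnW (ltn_ord x))) muln0 addn0 subnK.
move=> /= /andP[xy ps]; rewrite -(IH (x + t) y xy ps).
rewrite (eq_bigr (fun i : 'I_n => (lo <= i < x) + in_gap (x + t) (y :: s) i)); last first.
  move=> i _ /=; case E: (lo <= i < x) => //=.
  have := @in_gap_ge (x + t) y s i xy ps; rewrite /=.
  case: (_ || _) => // /(_ erefl); lia.
rewrite big_split /= sum_interval (minn_idPr (ltnW (ltn_ord x))) mulnS.
by lia.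
Qed.

(** [zip] stops at the end of the shorter sequence, so only common positions are compared. *)
Definition dominated s k := all (fun z : 'I_n * 'I_n => z.1 <= z.2) (zip s k).

(** The second alternative records the first position where the entry of [k] is below that of
    [s]. *)
Lemma dominated_or_split s k : size k <= size s ->
  dominated s k \/ exists p x r p' y r',
    [/\ s = p ++ x :: r, k = p' ++ y :: r', size p = size p', dominated p p' & y < x].
Proof.
elim: k s => [|y k IH] [|x s] //= ks; try by left.
have [xy|yx] := leqP x y; last first.
  by right; exists [::], x, s, [::], y, k.
have [sk|[p [x' [r [p' [y' [r' [-> -> pp' dp lt]]]]]]]] := IH s ks.
  by left; rewrite /dominated /= xy.
by right; exists (x :: p), x', r, (y :: p'), y', r'; rewrite /= pp' /dominated /= xy.
Qed.

Lemma dominated_all p p' (c : nat) : size p = size p' -> dominated p p' ->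
  all (fun z : 'I_n => z + t <= c) p' -> all (fun z : 'I_n => z + t <= c) p.
Proof.
move: p p'; apply: seq_ind2 => //= x x' p p' _ IH /andP[/= xx' /IH h].
by case/andP=> hx /h ->; rewrite andbT; lia.
Qed.

(** Where [p] has the entry y, [p'] has an entry both at least and at most y. *)
Lemma dominated_count p p' y : size p = size p' -> dominated p p' ->
  all (fun z : 'I_n => z <= y) p' -> count_mem y p <= count_mem y p'.
Proof.
move: p p'; apply: seq_ind2 => //= x x' p p' _ IH /andP[/= xx' /IH h].
case/andP=> hx /h hp; apply: leq_add => //.
have [xy|//] := eqVneq x y.
suff -> : x' = y by rewrite eqxx.
by apply: val_inj; rewrite -xy in hx *; apply/eqP; rewrite eqn_leq hx.
Qed.

Lemma dominated_sum s k : size s = size k -> dominated s k ->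
  \sum_(x <- k) x <= \sum_(x <- s) x -> s = k.
Proof.
move=> E d.
suff: size s = size k -> dominated s k -> \sum_(x <- s) x <= \sum_(x <- k) x /\
  (\sum_(x <- k) x <= \sum_(x <- s) x -> s = k) by case/(_ E d).
move: s k {E d}; apply: seq_ind2 => [|x x' s k _ IH]; first by rewrite big_nil.
case/andP=> /= xx' /IH[le eqs]; rewrite !big_cons; split; first by lia.
move=> h; rewrite eqs; last by lia.
by congr cons; apply: val_inj => /=; lia.
Qed.

End IndexSequences.

(** * Colon ideals of strongly stable sets of monomials *)

Section StronglyStableMonomials.
Variables (n t : nat) (us : seq 'X_{1..n}).
Local Open Scope nat_scope.
Local Notation spread := (@spread_rel n t).
Hypothesis us_antichain : {in us &, forall g h, (g <= h)%MM -> g = h}.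
Hypothesis us_spread : {in us, forall g, tspread t g}.
Hypothesis us_stable : forall (u : 'X_{1..n}) (i j : 'I_n),
  tspread t u -> mono_mult us u -> j \in mnm_supp u -> i < j ->
  tspread t (U_(i) + (u - U_(j)))%MM -> mono_mult us (U_(i) + (u - U_(j)))%MM.

Definition gap_vars (u : 'X_{1..n}) : seq 'I_n :=
  [seq i : 'I_n <- enum 'I_n | in_gap t 0 (mnm_indices u) i].

(** With 0-based indices, [sum_in_gap] gives j_d - t(d - 1); the final 1 is subtracted because
    [mnm_max] is j_d + 1. *)
Lemma size_gap_vars u : tspread t u -> 0 < mdeg u ->
  size (gap_vars u) = mnm_max u - t * (mdeg u - 1) - 1.
Proof.
rewrite tspreadE -{2 4 5}[u]mnm_indicesK mdeg_mnm_seq.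
have -> : size (gap_vars u) = \sum_(i < n) in_gap t 0 (mnm_indices u) i.
  by rewrite size_filter -sum1_count big_mkcond big_enum.
case: (mnm_indices u) => // x s ps _.
have /(sum_in_gap (leq0n x)) : path spread x s.
  by rewrite (path_pairwise (@spread_rel_trans n t)).
rewrite (mnm_max_seq ps) /=; lia.
Qed.

Lemma stable_replace p r (x y : 'I_n) : x < y ->
  pairwise spread (p ++ y :: r) -> pairwise spread (p ++ x :: r) ->
  mono_mult us (mnm_seq (p ++ y :: r)) -> mono_mult us (mnm_seq (p ++ x :: r)).
Proof.
move=> xy py px my; rewrite (mnm_seq_replace p r x y).
apply: us_stable => //; first exact: tspread_mnm_seq py.
  by rewrite inE mnmE count_cat /= eqxx addnCA.
by rewrite -mnm_seq_replace; apply: tspread_mnm_seq px.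
Qed.

(* Replacing the entries of [k] from left to right keeps the sequence t-spread. *)
Lemma dominated_mult p k s : size k <= size s -> dominated s k ->
  pairwise spread (p ++ k) -> pairwise spread (p ++ s) ->
  mono_mult us (mnm_seq (p ++ k)) -> mono_mult us (mnm_seq (p ++ take (size k) s)).
Proof.
elim: k p s => [|y k IH] p [|x s] //=.
rewrite ltnS => ks /andP[/= xy sk] pk ps mk.
have px : pairwise spread (p ++ x :: k).
  move: pk ps; rewrite !pairwise_cat !allrel_consr /=.
  case/and4P=> /andP[_ apk] -> /allP yk -> /andP[/andP[-> _] _].
  rewrite apk /= andbT; apply/allP=> z /yk; rewrite /spread_rel; lia.
have mx : mono_mult us (mnm_seq (p ++ x :: k)).
  move: xy; rewrite leq_eqVlt => /predU1P[/val_inj->//|xy].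
  exact: stable_replace xy pk px mk.
by rewrite -cat_rcons; apply: IH; rewrite ?cat_rcons.
Qed.

(** Let w be u with the first variable beyond the gap replaced by x_i. By stability some g divides
    w, which divides x_i u. Either g has smaller degree or g = w, whose weight is smaller. *)
Lemma gap_colon_sub (u : 'X_{1..n}) (i : 'I_n) : u \in us -> i \in gap_vars u ->
  exists2 g, g \in us & (g <= U_(i) + u)%MM /\
    (mdeg g < mdeg u \/ mdeg g = mdeg u /\ mnm_weight g < mnm_weight u).
Proof.
move=> uus; rewrite mem_filter => /andP[gi _].
have := us_spread uus; rewrite tspreadE => pu.
have [p [x [r [uE ix pi]]]] : exists p x r,
    [/\ mnm_indices u = p ++ x :: r, i < x & all (fun z : 'I_n => z + t <= i) p].
  case: (mnm_indices u) pu gi => // y s ps; apply: in_gap_split => //.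
  by rewrite (path_pairwise (@spread_rel_trans n t)).
have uS : u = mnm_seq (p ++ x :: r) by rewrite -uE mnm_indicesK.
rewrite uE in pu.
have pw : pairwise spread (p ++ i :: r).
  move: pu; rewrite !pairwise_cat !allrel_consr /=.
  case/and4P=> /andP[_ ->] -> /allP xr ->; rewrite !andbT /=; apply/andP; split=> //.
  by apply/allP=> z /xr; rewrite /spread_rel; lia.
have mu : mono_mult us u by apply/hasP; exists u => //; apply: lepm_refl.
have mw : mono_mult us (mnm_seq (p ++ i :: r)).
  by apply: stable_replace ix pu pw _; rewrite -uS.
have [g gus gw] := hasP mw; exists g => //; split.
  apply: lepm_trans gw _; rewrite (mnm_seq_replace p r i x) -uS.
  by apply/mnm_lepP=> z; rewrite !mnmE; lia.
have dw : mdeg (mnm_seq (p ++ i :: r)) = mdeg u.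
  by rewrite uS !mdeg_mnm_seq !size_cat.
have := congr1 (@mdeg n) (submK gw); rewrite mdegD dw.
have [->|nz] := eqVneq (mnm_seq (p ++ i :: r) - g)%MM 0%MM; last first.
  by move: nz; rewrite -mdeg_eq0 -lt0n; lia.
rewrite mdeg0 add0n => dg; right; split=> //.
have -> : g = mnm_seq (p ++ i :: r).
  rewrite -(submK gw); apply/esym; rewrite -[RHS](addm0 g) addmC; congr (_ + _)%MM.
  apply/eqP; rewrite -mdeg_eq0; have := congr1 (@mdeg n) (submK gw).
  by rewrite mdegD dw -dg => /eqP; rewrite -[X in _ == X]add0n eqn_add2r.
by rewrite uS !mnm_weight_seq !big_cat !big_cons /= ltn_add2l ltn_add2r.
Qed.

(* Otherwise the index sequence of [g] lies entrywise above that of [u]; by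
   stability a prefix of [u] of degree [mdeg g] is in the ideal, so it is [u], and
   comparing weights gives [g = u]. *)
Lemma gap_colon_sup (u g : 'X_{1..n}) : u \in us -> g \in us -> g != u ->
  mdeg g < mdeg u \/ mdeg g = mdeg u /\ mnm_weight g <= mnm_weight u ->
  exists2 i, i \in gap_vars u & u i < g i.
Proof.
move=> uus gus gu key.
have := us_spread uus; have := us_spread gus; rewrite !tspreadE.
set k := mnm_indices g; set s := mnm_indices u => pk ps.
have gE : g = mnm_seq k by rewrite mnm_indicesK.
have uE : u = mnm_seq s by rewrite mnm_indicesK.
have dE : mdeg g = size k /\ mdeg u = size s by rewrite {1}gE {1}uE !mdeg_mnm_seq.
have ks : size k <= size s by case: dE key => -> ->; lia.
have [dom|[p [x [r [p' [y [r' [sE kE pp' dp yx]]]]]]]] := dominated_or_split ks.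
  have mg : mono_mult us (mnm_seq k).
    by apply/hasP; exists g => //; rewrite -gE lepm_refl.
  have /hasP[h hus hle] := @dominated_mult [::] k s ks dom pk ps mg.
  have le_u : (mnm_seq (take (size k) s) <= u)%MM.
    rewrite uE -{2}(cat_take_drop (size k) s); apply/mnm_lepP=> i.
    by rewrite !mnmE count_cat leq_addr.
  have hu : h = u by apply: us_antichain => //; apply: lepm_trans le_u.
  have := congr1 (@mdeg n) (submK hle); rewrite mdegD mdeg_mnm_seq size_take_min.
  rewrite hu (proj2 dE) => szE.
  have szks : size s = size k by lia.
  case: key; first by rewrite (proj1 dE) (proj2 dE); lia.
  rewrite gE uE !mnm_weight_seq => -[_ /(dominated_sum szks dom) sk].
  by case/eqP: gu; rewrite gE uE sk.
move: pk; rewrite kE pairwise_cat allrel_consr => /and3P[/andP[p'y _] _ _].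
(* At the first position where g goes below u, the entries of u before it are at most those of g,
   hence at most y - t, and y < x: so y is in a gap. It occurs in [p] at most as often as in [p'],
   and not at all in [x :: r], so it has a larger exponent in g. *)
exists y.
  rewrite mem_filter mem_enum andbT -/s sE; apply: split_in_gap => //.
  exact: dominated_all dp p'y.
rewrite gE uE kE sE !mnmE !count_cat /= eqxx.
have c1 : count_mem y p <= count_mem y p'.
  apply: dominated_count dp _ => //; apply: sub_all p'y => z /=.
  by apply: leq_trans; apply: leq_addr.
have c2 : count_mem y r = 0.
  apply/count_memPn/negP=> yr; move: ps.
  rewrite sE pairwise_cat /= => /and4P[_ _ /allP/(_ y yr)]; rewrite /spread_rel; lia.
have -> : (x == y) = false by apply/eqP=> xy; rewrite xy ltnn in yx.
by rewrite c2 !addn0 addnCA ltnS (leq_trans c1) ?leq_addr.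
Qed.

End StronglyStableMonomials.

(** * Minimal generators *)

(* Induction on the number [k] of coordinates that are compared: a basis for the
   first [k] coordinates also handles the [m] whose next coordinate is large; the
   others lie in finitely many slices. *)
Lemma dickson n (P : 'X_{1..n} -> Prop) (k : nat) :
  exists s : seq 'X_{1..n}, {in s, forall g, P g} /\
    forall m, P m -> exists2 g, g \in s & forall i : 'I_n, (i < k -> g i <= m i)%N.
Proof.
elim: k P => [|k IH] P.
  have [[g Pg]|nP] := excluded_middle_informative (exists g, P g).
    exists [:: g]; split=> [h|m _]; first by rewrite inE => /eqP ->.
    by exists g; rewrite ?inE.
  by exists [::]; split=> // m Pm; case: nP; exists m.
have [s0 [s0P s0le]] := IH P.
have [kn|nk] := ltnP k n; last first.
  exists s0; split=> // m /s0le[g gs gm]; exists g => // i _.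
  by apply: gm; apply: leq_trans nk.
pose o := Ordinal kn.
have slices N : exists s : seq 'X_{1..n}, {in s, forall g, P g} /\
    forall m, P m -> (m o < N)%N ->
      exists2 g, g \in s & forall i : 'I_n, (i < k.+1 -> g i <= m i)%N.
  elim: N => [|N [s [sP sle]]]; first by exists [::].
  have [s' [s'P s'le]] := IH (fun m => P m /\ m o = N).
  exists (s ++ s'); split=> [g|m Pm].
    by rewrite mem_cat => /orP[/sP|/s'P[]].
  rewrite ltnS leq_eqVlt => /predU1P[mN|/(sle m Pm)[g gs gm]]; last first.
    by exists g; rewrite ?mem_cat ?gs.
  have [g gs gm] := s'le m (conj Pm mN).
  exists g; first by rewrite mem_cat gs orbT.
  move=> i; rewrite ltnS leq_eqVlt => /predU1P[ik|/gm//].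
  have -> : i = o by apply: val_inj.
  by rewrite mN (proj2 (s'P g gs)).
have [s [sP sle]] := slices (\max_(g <- s0) g o)%N.
exists (s0 ++ s); split=> [g|m Pm].
  by rewrite mem_cat => /orP[/s0P|/sP].
have [/(sle m Pm)[g gs gm]|le] := ltnP (m o) (\max_(g <- s0) g o).
  by exists g; rewrite ?mem_cat ?gs ?orbT.
have [g gs gm] := s0le m Pm; exists g; first by rewrite mem_cat gs.
move=> i; rewrite ltnS leq_eqVlt => /predU1P[ik|/gm//].
have -> : i = o by apply: val_inj.
by apply: leq_trans le; apply: leq_bigmax_seq.
Qed.

Section MinimalGenerators.
Variables (K : fieldType) (n : nat).
Local Notation S := {mpoly K[n]}.
Implicit Types (I : {pred S}) (G : {pred 'X_{1..n}}).

(** Membership is tested on monomials: conversely, each term of p is assigned to one chosen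
    generator that divides it. *)
Lemma mono_spanP G (p : S) :
  (exists2 s : seq (S * 'X_{1..n}),
     {in s, forall c, c.2 \in G} & p = \sum_(c <- s) c.1 * 'X_[c.2])
  <-> forall m, p@_m != 0 -> exists2 g, g \in G & (g <= m)%MM.
Proof.
split=> [[s sG ->] m|h].
  rewrite raddf_sum /= => /eqP nz; apply: NNPP => nG; case: nz.
  rewrite big1_seq // => c /andP[_ cs]; apply: memN_msupp_eq0.
  rewrite (perm_mem (msuppMX c.1 c.2)); apply/negP=> /mapP[m' _ mE].
  by case: nG; exists c.2; [exact: sG | rewrite mE lem_addr].
pose Q m g := (g \in G) && (g <= m)%MM.
have exg m : exists g, p@_m != 0 -> Q m g.
  (* Outside the support of p the monomial 1 is a mere default value. *)
  have [/h[g gG gm]|_] := boolP (p@_m != 0); last by exists 0%MM.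
  by exists g; rewrite /Q gG.
pose d m := sval (constructive_indefinite_description _ (exg m)).
have dP m : p@_m != 0 -> Q m (d m).
  exact: svalP (constructive_indefinite_description _ (exg m)).
exists [seq (p@_m *: 'X_[m - d m], d m) | m <- msupp p].
  by move=> _ /mapP[m + ->]; rewrite mcoeff_msupp => /dP/andP[].
rewrite big_map {1}[p]mpolyE; apply: eq_big_seq => m.
rewrite mcoeff_msupp => /dP/andP[_ le] /=.
by rewrite -scalerAl -mpolyXD submK.
Qed.

Variables (I : {pred S}) (G : {pred 'X_{1..n}}).
Hypothesis hG : minimal_generators I G.

Lemma mem_mingenP (p : S) :
  p \in I <-> forall m, p@_m != 0 -> exists2 g, g \in G & (g <= m)%MM.
Proof. by case: hG => gG _; rewrite gG mono_spanP. Qed.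

Lemma mem_mingenX m : 'X_[m] \in I <-> exists2 g, g \in G & (g <= m)%MM.
Proof.
rewrite mem_mingenP; split=> [h|h m'].
  by apply: h; rewrite mcoeffX eqxx oner_neq0.
by rewrite mcoeffX; have [<-|_] := eqVneq m m'; rewrite ?eqxx.
Qed.

(** A subset whose members divide every element of G still generates I, so minimality applies. *)
Lemma mingen_sub (G' : {pred 'X_{1..n}}) : {subset G' <= G} ->
  {in G, forall g, exists2 h, h \in G' & (h <= g)%MM} -> {subset G <= G'}.
Proof.
move=> sub dom; case: hG => _; apply=> // p; rewrite mem_mingenP mono_spanP.
split=> h m /h[g gG gm]; last by exists g; first exact: sub.
by have [g' g'G le] := dom g gG; exists g' => //; apply: lepm_trans gm.
Qed.

(** If g properly divided h, then G without h would still generate I. *)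
Lemma mingen_antichain : {in G &, forall g h, (g <= h)%MM -> g = h}.
Proof.
move=> g h gG hG' gh; apply/eqP/negPn/negP=> gNh.
have : h \in [pred x | (x \in G) && (x != h)].
  apply: mingen_sub hG' => [x /andP[]//|x xG].
  have [->|xh] := eqVneq x h; first by exists g; rewrite // inE gG.
  by exists x; rewrite ?lepm_refl // inE xG.
by rewrite inE eqxx andbF.
Qed.

(** Dickson's lemma yields a finite subset dividing all of G; by minimality it is all of G. *)
Lemma mingen_finite : exists s, uniq s /\ s =i G.
Proof.
have [s [sG sle]] := dickson (fun g => g \in G) n.
exists (undup s); split=> [|g]; first exact: undup_uniq.
rewrite mem_undup; apply/idP/idP; first exact: sG.
apply: (@mingen_sub (mem s)) => // m /sle[h hs hm]; exists h => //.
by apply/mnm_lepP=> i; apply: hm.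
Qed.

(** Some t-spread generator g0 divides g, and some h in G divides g0. The antichain property gives h
    = g, hence g = g0. *)
Lemma mingen_tspread t : tspread_monomial_ideal t I -> {in G, forall g, tspread t g}.
Proof.
case=> G0 G0t gG0 g gG; have : 'X_[g] \in I.
  by apply/mem_mingenX; exists g; rewrite ?lepm_refl.
rewrite gG0 mono_spanP => /(_ g)[|g0 g0G le]; first by rewrite mcoeffX eqxx oner_neq0.
have : 'X_[g0] \in I.
  rewrite gG0 mono_spanP => m; rewrite mcoeffX.
  by have [<- _|_] := eqVneq g0 m; [exists g0; rewrite ?lepm_refl | rewrite eqxx].
case/mem_mingenX=> h hG' hle.
have hg : h = g by apply: mingen_antichain => //; apply: lepm_trans le.
suff -> : g = g0 by apply: G0t.
apply/mnmP=> i; apply/eqP; rewrite eqn_leq (mnm_lepP le i) -hg.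
by rewrite (mnm_lepP hle i).
Qed.

End MinimalGenerators.

(** * Betti numbers of t-spread strongly stable ideals *)

Theorem corollary1p12 (K : fieldType) (n t : nat)
    (I : {pred {mpoly K[n]}}) (hI : tspread_strongly_stable t I)
    (G : {pred 'X_{1..n}}) (hG : minimal_generators I G)
    (i j : nat) (hj : (1 <= j)%N) :
  graded_betti I i (i + j)%N =
  (\sum_(u : 'X_{1..n < j.+1} | (mdeg u == j) && (bmnm u \in G))
     'C(mnm_max u - t * (j - 1) - 1, i))%N.
Proof.
have [s [us sG]] := mingen_finite hG.
(* The order is decreasing, as the generators preceding u must form the tail of the list after u. *)
pose r : rel 'X_{1..n} := fun u v => (mdeg v < mdeg u)%N ||
  ((mdeg v == mdeg u) && (mnm_weight v <= mnm_weight u)%N).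
pose gs := sort r s.
have r_tr : transitive r by move=> a b c; rewrite /r; lia.
have sgs : pairwise r gs.
  rewrite -(sorted_pairwise r_tr); apply: sort_sorted => a b; rewrite /r; lia.
have ugs : uniq gs by rewrite sort_uniq.
have gsG : gs =i G by move=> g; rewrite mem_sort sG.
have [spI stI] := hI.
have spG : {in gs, forall g, tspread t g}.
  by move=> g; rewrite gsG; apply: (mingen_tspread hG).
have anti : {in gs &, forall g h, (g <= h)%MM -> g = h}.
  by move=> g h; rewrite !gsG; apply: (mingen_antichain hG).
have mI m : 'X_[m] \in I <-> mono_mult gs m.
  rewrite (mem_mingenX hG); split=> [[g gG gm]|/hasP[g gG gm]].
    by apply/hasP; exists g; rewrite ?gsG.
  by exists g; rewrite // -gsG.
have stM (u : 'X_{1..n}) (a b : 'I_n) : tspread t u -> mono_mult gs u ->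
    b \in mnm_supp u -> (a < b)%N ->
    tspread t (U_(a) + (u - U_(b)))%MM -> mono_mult gs (U_(a) + (u - U_(b)))%MM.
  by move=> tu /mI mu bu ab tw; apply/mI; exact: stI tu mu bu ab tw.
have [|d [F [rF mF _ bF]]] := @linear_quotients_resolution K n gs (gap_vars t).
  move=> s1 u s2 E.
  have uus : u \in gs by rewrite E mem_cat mem_head orbT.
  have [us2 key1 key2] : [/\ u \notin s2, {in s1, forall g, r g u}
                           & {in s2, forall g, r u g}].
    move: ugs sgs; rewrite E cat_uniq /= => /and4P[_ _ -> _].
    rewrite pairwise_cat allrel_consr /= => /and4P[/andP[/allP h1 _] _ /allP h2 _].
    by split.
  have s2gs g : g \in s2 -> g \in gs.
    by move=> h; rewrite E mem_cat inE h !orbT.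
  split.
  - by rewrite filter_uniq ?enum_uniq.
  - by move=> g /key2; rewrite /r; lia.
  move=> m; apply/idP/idP=> [/hasP[g gs2 gm]|/hasP[x xg xm]].
    have gu : g != u by apply: contraNneq us2 => <-.
    have [|x xg xlt] := gap_colon_sup anti spG stM uus (s2gs g gs2) gu.
      by have := key2 g gs2; rewrite /r; lia.
    apply/hasP; exists x => //; have := mnm_lepP gm x; rewrite mnmDE; lia.
  (* The elements of [s1] have degree and weight at least as large as u in the order, while g is
     strictly smaller; hence g is in [s2]. *)
  have [g gG [gle key]] := gap_colon_sub spG stM uus xg.
  apply/hasP; exists g; last first.
    apply: lepm_trans gle _; apply/mnm_lepP=> y; rewrite !mnmDE mnm1E.
    by have [<-|_] := eqVneq x y; lia.
  move: gG; rewrite {1}E mem_cat inE => /or3P[/key1|/eqP gu|//].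
    by rewrite /r; lia.
  by move: key; rewrite gu; lia.
have {}rF : aug_resolution I F.
  apply: eq_aug_resolution rF => p; rewrite mono_idealP (mem_mingenP hG).
  split=> h m nz; first by have/hasP[g] := h m nz; rewrite gsG => gG gm; exists g.
  by have [g gG gm] := h m nz; apply/hasP; exists g; rewrite ?gsG.
(* The resolution just built shows that one exists, so [epsilon] does choose a resolution of I. *)
have rI : aug_resolution I (free_resolution I).
  apply/aug_resolutionP; apply: epsilon_spec; exists F.
  exact/aug_resolutionP.
have -> : graded_betti I i (i + j) = homology_dim F i (i + j).
  by apply/eqP; rewrite eqn_leq !(@homology_dim_le _ _ I).
rewrite minimal_homology_dim // bF.
(* i + deg u = i + j leaves only the generators of degree j. *)
rewrite (eq_bigr (fun u : 'X_{1..n} =>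
  if mdeg u == j then 'C(size (gap_vars t u), i) else 0))%N; last first.
  by move=> u _; rewrite eqn_add2l; case: eqP; rewrite ?muln1 ?muln0.
rewrite -big_mkcond -big_filter.
pose hs := [seq u <- enum {: 'X_{1..n < j.+1}} | (mdeg (bmnm u) == j) && (bmnm u \in G)].
rewrite (perm_big [seq bmnm u | u <- hs]); last first.
  apply: uniq_perm; first by rewrite filter_uniq.
    rewrite map_inj_uniq; last by move=> u v h; apply: val_inj.
    by apply: filter_uniq; apply: enum_uniq.
  move=> u; rewrite mem_filter gsG; apply/idP/mapP=> [/andP[/eqP uj uG]|[v + ->]].
    have uj' : (mdeg u < j.+1)%N by rewrite uj.
    by exists (BMultinom uj') => //; rewrite mem_filter mem_enum /= uj eqxx uG.
  by rewrite mem_filter => /andP[].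
rewrite big_map big_filter big_enum_cond; apply: eq_bigr => u /andP[_ /andP[/eqP uj uG]].
rewrite size_gap_vars; [by rewrite uj | by apply: spG; rewrite gsG | by rewrite uj].
Qed.
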